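(* For any partition $P$ of the edges of the complete bipartite graph $K_{n,n}$ into $m$ color classes, there is a perfect matching $M$ of $K_{n,n}$ such that $$\Big\| x(M,P)-\frac{1}{n}x(K_{n,n},P)\Big\|_\infty\le\Big\| x(M,P)-\frac{1}{n}x(K_{n,n},P)\Big\|_2<(m-1)2^{(3m-2)/2}.$$
   Context: For a graph $G$ whose edge set is partitioned by $P$ into color classes $E_1,\dots,E_m$ and a subgraph $H'=(V',E')$ of $G$, $x(H',P)$ denotes the vector $(x_1,\dots,x_m)$ with $x_i=|E_i\cap E'|$.
   Formalization: The theorem is stated for n ≥ 1 and m ≥ 2 color classes: for m = 1 both norms equal 0 and the bound (m-1)2^{(3m-2)/2} is also 0, so the strict inequality fails. *)

(* Defs.v *)
From HB Require Import structures.
From mathcomp Require Import all_boot all_order all_algebra.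
From mathcomp Require Import all_classical all_reals all_analysis.

Set Implicit Arguments.
Unset Strict Implicit.
Unset Printing Implicit Defensive.

Import Order.TTheory GRing.Theory Num.Theory.
Import numFieldNormedType.Exports.
Local Open Scope ring_scope.

(* A simple graph on a finite vertex type T is a symmetric irreflexive         *)
(* adjacency relation; an edge is the two-element set of its endpoints.        *)
Definition edges (T : finType) (adj : rel T) : {set {set T}} :=
  [set [set p.1; p.2] | p : T * T & adj p.1 p.2].

Definition Kbip (n : nat) : rel ('I_n + 'I_n) := fun u v =>
  match u, v with
  | inl _, inr _ | inr _, inl _ => true
  | _, _ => false
  end.

Lemma Kbip_sym (n : nat) : symmetric (@Kbip n).
Proof. by case=> i [] j. Qed.

Lemma Kbip_irr (n : nat) : irreflexive (@Kbip n).
Proof. by case. Qed.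

(* The classes are indexed, since the coordinates of x(H', P) are; a class is  *)
(* allowed to be empty, i.e. a colour may remain unused.                       *)
Definition edge_partition (T : finType) (adj : rel T) (m : nat)
    (P : 'I_m -> {set {set T}}) : Prop :=
  \bigcup_(i < m) P i = edges adj /\
  (forall i j : 'I_m, i != j -> [disjoint P i & P j]).

Definition perfect_matching (T : finType) (adj : rel T) (M : {set {set T}}) :
    Prop :=
  M \subset edges adj /\ (forall v : T, #|[set e in M | v \in e]| = 1%N).

(* x(H', P): it depends on the subgraph H' = (V', E') only through E'.         *)
Definition color_vector (R : realType) (T : finType) (m : nat)
    (E' : {set {set T}}) (P : 'I_m -> {set {set T}}) : 'rV[R]_m :=
  \row_i #|P i :&: E'|%:R.

(* The norm `|v| which the library puts on 'rV[R]_m is the max norm.           *)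
Definition l2norm (R : realType) (m : nat) (v : 'rV[R]_m) : R :=
  Num.sqrt (\sum_(i < m) v ord0 i ^+ 2).

(* Main.v *)
(** Let [sigma] be a permutation minimizing the Euclidean norm of the deviation
    [v] of its colour vector from the average, and let [D_p] be the change of the
    colour vector caused by composing [sigma] with the transposition of a pair [p].
    Minimality gives [<v, D_p> >= -|D_p|^2 / 2 >= -4], while the sum of [D_p] over
    all ordered pairs is [-2 n v], so that [-v] lies in the cone spanned by the
    [D_p]. By Caratheodory [-v] is a nonnegative combination of at most [m - 1] of
    them, linearly independent after deleting one coordinate where [v] does not
    vanish. These vectors are integral of norm at most [sqrt 8], so Cramer's rule
    and Hadamard's inequality bound each coefficient by [8^((m-2)/2) |v'|], where
    [v'] is [v] without that coordinate. Pairing [-v] with [v] yields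
    [|v|^2 <= 4 (m-1) 8^((m-2)/2) |v'|], and [|v'| < |v|]. *)
Require Import Defs.
From HB Require Import structures.
From mathcomp Require Import all_boot all_order all_algebra all_fingroup.
From mathcomp Require Import all_classical all_reals all_analysis.
From mathcomp Require Import ring lra.

Import Order.TTheory GRing.Theory Num.Theory.
Import numFieldNormedType.Exports.
Local Open Scope ring_scope.

(** * Gram determinants and Hadamard's inequality *)

Lemma gram_diag (F : comPzRingType) (r d : nat) (A : 'M[F]_(r, d)) (i : 'I_r) :
  (A *m A^T) i i = \sum_j A i j ^+ 2.
Proof. by rewrite mxE; apply: eq_bigr => j _; rewrite mxE expr2. Qed.

(* Induction on the rows: projecting the others off the first one leaves the Gram
   determinant unchanged, makes it block diagonal, and shrinks the diagonal. *)
Lemma det_gram_le (F : realFieldType) (r d : nat) (A : 'M[F]_(r, d)) :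
  \det (A *m A^T) <= \prod_i (A *m A^T) i i.
Proof.
elim: r A => [|r IH] A; first by rewrite det_mx00 big_ord0.
rewrite -[r.+1]/(1 + r)%N in A *.
pose a := @usubmx F 1 r d A; pose A' := @dsubmx F 1 r d A.
have -> : A = col_mx a A' by rewrite vsubmxK.
move: a A' => a A' {A}.
set g := (a *m a^T) ord0 ord0.
have gE : a *m a^T = g%:M by rewrite [LHS]mx11_scalar.
have g_ge0 : 0 <= g by rewrite /g gram_diag sumr_ge0 // => j _; exact: sqr_ge0.
pose c := g^-1 *: (A' *m a^T).
pose B := A' - c *m a.
have AE : A' = B + c *m a by rewrite subrK.
have Ba : B *m a^T = 0.
  rewrite mulmxBl -mulmxA gE mul_mx_scalar scalerA.
  (* If [g = 0], the default [g^-1 = 0] is harmless: [a] has zero norm, hence vanishes. *)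
  have [g0|gN0] := eqVneq g 0; last by rewrite divff // scale1r subrr.
  have -> : a = 0.
    apply/rowP => j; rewrite mxE; apply/eqP.
    move: g0; rewrite /g gram_diag => /eqP.
    rewrite psumr_eq0 => [|k _]; last exact: sqr_ge0.
    by move=> /allP /(_ j); rewrite mem_index_enum sqrf_eq0 => /(_ isT).
  by rewrite trmx0 mulmx0 scaler0 subrr.
have aB : a *m B^T = 0 by apply: trmx_inj; rewrite trmx_mul trmxK Ba trmx0.
have A'A' : A' *m A'^T = B *m B^T + g *: (c *m c^T).
  rewrite AE linearD /= trmx_mul mulmxDl !mulmxDr (mulmxA B a^T) Ba mul0mx addr0.
  rewrite -(mulmxA c a B^T) aB mulmx0 add0r.
  by rewrite -mulmxA (mulmxA a) gE mul_scalar_mx -scalemxAr.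
pose L := block_mx (1%:M : 'M[F]_1) 0 c (1%:M : 'M[F]_r).
have LE : col_mx a A' = L *m col_mx a B.
  by rewrite /L mul_block_col !mul1mx mul0mx addr0 addrC -AE.
have -> : \det (col_mx a A' *m (col_mx a A')^T) = g * \det (B *m B^T).
  rewrite LE trmx_mul -mulmxA [_ *m (_ *m L^T)]mulmxA 2!det_mulmx det_tr.
  rewrite det_lblock !det1 !mul1r mulr1.
  rewrite tr_col_mx mul_col_row aB Ba gE det_lblock.
  by rewrite det_scalar1.
rewrite (@big_split_ord _ _ _ 1 r) /= big_ord1 tr_col_mx mul_col_row.
rewrite block_mxEul -/g ler_wpM2l //.
(* Pythagoras: each row of [A'] is at least as long as its projection in [B]. *)
apply: le_trans (IH B) _; apply: ler_prod => i _.
rewrite block_mxEdr A'A' gram_diag sumr_ge0 /= => [|j _]; last exact: sqr_ge0.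
rewrite [leRHS]mxE gram_diag lerDl mxE mulr_ge0 // gram_diag sumr_ge0 // => j _.
exact: sqr_ge0.
Qed.

Lemma hadamard (F : realFieldType) (r : nat) (A : 'M[F]_r) :
  \det A ^+ 2 <= \prod_i \sum_j A i j ^+ 2.
Proof.
rewrite expr2 -{2}det_tr -det_mulmx; apply: le_trans (det_gram_le _ _ _ A) _.
by rewrite le_eqVlt; apply/orP; left; apply/eqP; apply: eq_bigr => i _; rewrite gram_diag.
Qed.

(** * Conic combinations and integral coefficient bounds *)

Lemma conic_caratheodory (F : realFieldType) (J : Type) (d : nat)
    (D : J -> 'I_d -> F) (r : nat) (f : 'I_r -> J) (mu : 'I_r -> F) :
    (forall k, 0 <= mu k) ->
  exists (s : nat) (g : 'I_s -> J) (nu : 'I_s -> F),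
    [/\ forall k, 0 <= nu k, row_free (\matrix_(k, j) D (g k) j) &
        forall j, \sum_k nu k * D (g k) j = \sum_k mu k * D (f k) j].
Proof.
elim: r f mu => [|r IH] f mu mu_ge0.
  by exists 0%N, f, mu; split=> //; rewrite /row_free flatmx0 mxrank0.
set A := \matrix_(k, j) D (f k) j.
have [Afree|Adep] := boolP (row_free A); first by exists r.+1, f, mu.
have [nu [nuA [k0 nu_gt0]]] : exists nu : 'rV[F]_r.+1,
    nu *m A = 0 /\ exists k, 0 < nu 0 k.
  have : kermx A != 0 by rewrite kermx_eq0.
  case/rowV0Pn => nu /sub_kermxP nuA /rV0Pn [k nuk].
  (* The relation may be negated, so a positive entry can be assumed; the minimal ratio below is
     taken over such entries. *)
  have [nu_lt0|nu_gt0|nu0] := ltgtP (nu 0 k) 0.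
  - exists (- nu); rewrite mulNmx nuA oppr0; split=> //.
    by exists k; rewrite mxE oppr_gt0.
  - by exists nu; split=> //; exists k.
  - by rewrite nu0 eqxx in nuk.
pose ratio k := mu k / nu 0 k.
have [k1 nu1_gt0 k1_min] :
    exists2 k1, 0 < nu 0 k1 & forall k, 0 < nu 0 k -> ratio k1 <= ratio k.
  case: (@Order.TotalTheory.arg_minP _ _ _ k0 (fun k => 0 < nu 0 k) ratio nu_gt0).
  by move=> k1 h1 h2; exists k1.
(* [nu] is a linear relation; moving along it until the first coefficient of [mu]
   vanishes keeps the sum. *)
pose mu' k := mu k - ratio k1 * nu 0 k.
have mu'_ge0 k : 0 <= mu' k.
  rewrite subr_ge0; have [nuk|nuk] := ltP 0 (nu 0 k).
    by rewrite -ler_pdivlMr // k1_min.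
  apply: le_trans (mu_ge0 k); apply: mulr_ge0_le0 => //.
  by rewrite divr_ge0 // ltW.
have mu'k1 : mu' k1 = 0 by rewrite /mu' /ratio divfK ?subrr // gt_eqF.
have [s [g [rho [h1 h2 h3]]]] := IH (f \o lift k1) (mu' \o lift k1)
  (fun k => mu'_ge0 _).
exists s, g, rho; split=> // j; rewrite h3 /=.
transitivity (\sum_k mu' k * D (f k) j).
  by rewrite [RHS](bigD1_ord k1) //= mu'k1 mul0r add0r.
transitivity (\sum_k (mu k * D (f k) j - ratio k1 * (nu 0 k * A k j))).
  by apply: eq_bigr => k _; rewrite mxE mulrA -mulrBl.
rewrite sumrB -mulr_sumr.
have <- : (nu *m A) 0 j = \sum_k nu 0 k * A k j by rewrite mxE.
by rewrite nuA mxE mulr0 subr0.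
Qed.

Lemma det_int (F : archiRealFieldType) (r : nat) (A : 'M[F]_r) :
  (forall i j, A i j \is a Num.int) -> \det A \is a Num.int.
Proof.
by move=> Aint; apply: rpred_sum => s _; rewrite rpredMsign rpred_prod.
Qed.

Lemma sum_inj_le (F : realFieldType) (r d : nat) (f : 'I_r -> 'I_d) (w : 'I_d -> F) :
  injective f -> (forall j, 0 <= w j) -> \sum_i w (f i) <= \sum_j w j.
Proof.
move=> f_inj w_ge0.
rewrite -(big_imset w (in2W f_inj)) /= [leRHS](bigID (fun j => j \in f @: 'I_r)) /=.
by rewrite lerDl sumr_ge0.
Qed.

(* Cramer's rule on a nonsingular square block of columns, whose integral
   determinant has absolute value at least 1. *)
Lemma row_coef_sqr_le (F : archiRealFieldType) (r d : nat) (A : 'M[F]_(r, d))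
    (c : F) (mu : 'rV[F]_r) (k : 'I_r) :
    row_free A -> (forall i j, A i j \is a Num.int) ->
    (forall i, \sum_j A i j ^+ 2 <= c) ->
  mu 0 k ^+ 2 <= c ^+ r.-1 * \sum_j (mu *m A) 0 j ^+ 2.
Proof.
move=> Afree Aint Ac.
have sum_ge0 p q (B : 'M[F]_(p, q)) i : 0 <= \sum_j B i j ^+ 2.
  by apply: sumr_ge0 => j _; exact: sqr_ge0.
have ATfull : row_full A^T by rewrite /row_full mxrank_tr.
pose f := fullrankfun ATfull.
have f_inj : injective f by exact: fullrankfun_inj.
pose B := colsub f A.
have B_unit : \det B != 0.
  rewrite -unitfE -unitmxE -unitmx_tr.
  have -> : B^T = rowsub f A^T by apply/matrixP => x y; rewrite !mxE.
  exact: fullrowsub_unit.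
have detB_ge1 : 1 <= \det B ^+ 2.
  by apply: sqr_intr_ge1 => //; apply: det_int => i j; rewrite mxE.
pose w := mu *m A.
(* Replacing row [k] of [B] by the selected entries of [mu *m A] multiplies the determinant by
   [mu 0 k]. *)
pose C := \matrix_(i, j) if i == k then w 0 (f j) else B i j.
have detC : \det C = mu 0 k * \det B.
  rewrite (expand_det_row C k).
  transitivity ((mu *m B *m \adj B) 0 k); last first.
    by rewrite -mulmxA mul_mx_adj mul_mx_scalar mxE mulrC.
  rewrite [RHS]mxE; apply: eq_bigr => j _; congr (_ * _).
    rewrite !mxE eqxx; apply: eq_bigr => l _; by rewrite [in RHS]mxE.
  rewrite [RHS]mxE /cofactor; congr (_ * \det _).
  by apply/matrixP => x y; rewrite !mxE eq_sym (negbTE (neq_lift k x)).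
have := hadamard _ _ C.
rewrite detC exprMn => hC.
apply: (@le_trans _ _ (mu 0 k ^+ 2 * \det B ^+ 2)).
  by rewrite ler_peMr // sqr_ge0.
apply: le_trans hC _.
(* Row [k] of [C] contributes the norm of [w]; the other [r.-1] rows contribute at most [c] each. *)
rewrite (bigD1_ord k) //= mulrC.
have -> : c ^+ r.-1 = \prod_(i < r.-1) c by rewrite prodr_const card_ord.
apply: ler_pM.
- by apply: prodr_ge0 => i _; exact: sum_ge0.
- exact: sum_ge0.
- apply: ler_prod => i _; rewrite sum_ge0 /=.
  apply: le_trans (Ac (lift k i)).
  apply: le_trans (sum_inj_le _ _ _ f (fun j => A (lift k i) j ^+ 2) f_inj _);
    last by move=> j; exact: sqr_ge0.
  apply: ler_sum => j _.
  by rewrite !mxE eq_sym (negbTE (neq_lift k i)).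
- apply: le_trans (sum_inj_le _ _ _ f (fun j => w 0 j ^+ 2) f_inj _);
    last by move=> j; exact: sqr_ge0.
  by apply: ler_sum => j _; rewrite mxE eqxx.
Qed.

(** The geometric half of the argument, free of graphs: [d.+1] is the number of colours, [v] the
    deviation, and [D p] the change caused by the swap [p]. *)
Lemma cone_norm_lt (R : archiRcfType) (J : finType) (d : nat)
    (D : J -> 'I_d.+1 -> R) (v : 'I_d.+1 -> R) (lam : J -> R) :
    (0 < d)%N ->
    (forall p k, D p k \is a Num.int) ->
    (forall p, \sum_k D p k = 0) ->
    (forall p, \sum_k D p k ^+ 2 <= 8) ->
    (forall p, 0 <= lam p) ->
    (forall k, \sum_p lam p * D p k = - v k) ->
    (forall p, -4 <= \sum_k v k * D p k) ->
  Num.sqrt (\sum_k v k ^+ 2) < d%:R * (4 * Num.sqrt 8 ^+ d.-1).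
Proof.
move=> d_gt0 Dint Dsum Dnorm lam_ge0 lamv vD.
set S := \sum_k v k ^+ 2; set K := d%:R * _.
have sqrt8_ge1 : 1 <= Num.sqrt 8 :> R by rewrite -[leLHS]sqrtr1 ler_sqrt //; lra.
have K_gt0 : 0 < K.
  by rewrite !mulr_gt0 ?exprn_gt0 ?ltr0n // (lt_le_trans ltr01).
have S_ge0 : 0 <= S by apply: sumr_ge0 => k _; exact: sqr_ge0.
(* Deleting a coordinate where [v] is nonzero strictly shortens [v]; this is the source of the
   strict inequality. *)
have [i0 vi0|v0] := pickP (fun k => v k != 0); last first.
  rewrite /S big1 ?sqrtr0 // => k _.
  by move/negbFE/eqP: (v0 k) => ->; rewrite expr0n.
have [s [g [nu [nu_ge0 g_free nuv]]]] := conic_caratheodory R J d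
  (fun p j => D p (lift i0 j)) #|J| enum_val (lam \o enum_val)
  (fun k => lam_ge0 _).
have {}nuv j : \sum_k nu k * D (g k) (lift i0 j) = - v (lift i0 j).
  by rewrite nuv -lamv [RHS](reindex _ (onW_bij _ (enum_val_bij J))).
have v_sum : \sum_k v k = 0.
  apply/eqP; rewrite -oppr_eq0 -sumrN; apply/eqP.
  under eq_bigr do rewrite -lamv.
  rewrite exchange_big big1 //= => p _.
  by rewrite -mulr_sumr Dsum mulr0.
have split_i0 (u : 'I_d.+1 -> R) : \sum_i u i = u i0 + \sum_j u (lift i0 j).
  by rewrite (bigD1_ord i0).
(* The dropped coordinate is recovered from the vanishing coordinate sums. *)
have {}nuvT i : \sum_k nu k * D (g k) i = - v i.
  have [j ->|->] := unliftP i0 i; first exact: nuv.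
  have Di0 k : D (g k) i0 = - \sum_j D (g k) (lift i0 j).
    by apply/eqP; rewrite -addr_eq0 -split_i0 Dsum.
  have -> : v i0 = - \sum_j v (lift i0 j).
    by apply/eqP; rewrite -addr_eq0 -split_i0 v_sum.
  under eq_bigr do rewrite Di0 mulrN mulr_sumr.
  rewrite sumrN exchange_big; congr (- _).
  by rewrite /= -sumrN; apply: eq_bigr => j _; rewrite -nuv.
set A := \matrix_(k, j) _ in g_free.
have s_le_d : (s <= d)%N by rewrite -(eqP g_free) rank_leq_col.
pose T := \sum_j v (lift i0 j) ^+ 2.
have T_ge0 : 0 <= T by apply: sumr_ge0 => k _; exact: sqr_ge0.
have T_lt_S : T < S.
  by rewrite /S (bigD1_ord i0) //= ltrDr lt0r sqrf_eq0 vi0 sqr_ge0.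
pose b := Num.sqrt 8 ^+ d.-1 * Num.sqrt T.
have nu_le k : nu k <= b.
  have b_ge0 : 0 <= b by rewrite mulr_ge0 ?exprn_ge0 ?sqrtr_ge0.
  rewrite -ler_sqr ?nnegrE //.
  have Ac i : \sum_j A i j ^+ 2 <= 8.
    apply: le_trans (Dnorm (g i)); rewrite [leRHS](bigD1_ord i0) //=.
    under eq_bigr do rewrite mxE.
    by rewrite lerDr sqr_ge0.
  have Aint i j : A i j \is a Num.int by rewrite mxE.
  have := row_coef_sqr_le R s d A 8 (\row_k nu k) k g_free Aint Ac.
  rewrite mxE.
  have -> : \sum_j ((\row_k nu k) *m A) 0 j ^+ 2 = T.
    apply: eq_bigr => j _; rewrite mxE -[RHS]sqrrN -nuv.
    by congr (_ ^+ 2); apply: eq_bigr => l _; rewrite !mxE.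
  move=> /le_trans; apply.
  rewrite exprMn sqr_sqrtr // -exprM mulnC exprM sqr_sqrtr; last by lra.
  (* The exponent [s.-1] is raised to [d.-1], as [s <= d] and [8 >= 1]. *)
  apply: ler_wpM2r => //; apply: ler_weXn2l; first by lra.
  by case: (s) s_le_d => [|s'] //=; case: (d).
have S_le : S <= K * Num.sqrt T.
  (* The conic expression of [-v] is paired with [v]; each pairing with a [D (g k)] is at least
     [-4]. *)
  have -> : S = - \sum_k nu k * \sum_i v i * D (g k) i.
    under [in RHS]eq_bigr do rewrite mulr_sumr.
    rewrite exchange_big /= -sumrN; apply: eq_bigr => i _.
    under eq_bigr do rewrite mulrCA.
    by rewrite -mulr_sumr nuvT mulrN opprK expr2.
  rewrite -sumrN.
  apply: (@le_trans _ _ (\sum_(k < s) 4 * b)).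
    apply: ler_sum => k _; apply: (@le_trans _ _ (nu k * 4)).
      by rewrite -mulrN; apply: ler_wpM2l; rewrite // lerNl.
    by rewrite mulrC; apply: ler_wpM2l.
  rewrite sumr_const card_ord -[leLHS]mulr_natl /K /b -!mulrA.
  by apply: ler_wpM2r; rewrite ?ler_nat // mulr_ge0 ?mulr_ge0 ?exprn_ge0 ?sqrtr_ge0.
have S_gt0 : 0 < S by exact: le_lt_trans T_lt_S.
have sqrtS_gt0 : 0 < Num.sqrt S by rewrite sqrtr_gt0.
rewrite -(ltr_pM2r sqrtS_gt0) -expr2 sqr_sqrtr //.
by apply: le_lt_trans S_le _; rewrite ltr_pM2l // ltr_sqrt.
Qed.

(** * Transpositions and a minimizing permutation *)

Lemma sum_tperm (R : comPzRingType) (n : nat) (g : 'I_n -> 'I_n -> R) (s : 'S_n)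
    (a b : 'I_n) :
  \sum_i g i ((tperm a b * s)%g i) =
  \sum_i g i (s i) + (g a (s b) + g b (s a) - g a (s a) - g b (s b)).
Proof.
have [->|aNb] := eqVneq a b.
  by rewrite tperm1 mul1g addrK subrr addr0.
have bNa : b != a by rewrite eq_sym.
rewrite (bigD1 a) // (bigD1 b) //= [in RHS](bigD1 a) // [in RHS](bigD1 b) //=.
rewrite !permM tpermL tpermR.
have -> : \sum_(i | (i != a) && (i != b)) g i ((tperm a b * s)%g i) =
          \sum_(i | (i != a) && (i != b)) g i (s i).
  apply: eq_bigr => i /andP[iNa iNb].
  by rewrite permM tpermD // eq_sym.
by ring.
Qed.

Lemma perm_near_average (R : archiRcfType) (n m : nat)
    (c : 'I_n -> 'I_n -> 'I_m.+1 -> bool) :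
    (0 < n)%N -> (0 < m)%N -> (forall i j, \sum_k (c i j k)%:R = 1 :> R) ->
  exists s : 'S_n,
    Num.sqrt (\sum_k (\sum_i (c i (s i) k)%:R -
                      n%:R^-1 * \sum_i \sum_j (c i j k)%:R) ^+ 2 : R)
    < m%:R * (4 * Num.sqrt 8 ^+ m.-1).
Proof.
move=> n_gt0 m_gt0 c_sum.
pose x (s : 'S_n) k : R := \sum_i (c i (s i) k)%:R.
pose t k : R := n%:R^-1 * \sum_i \sum_j (c i j k)%:R.
pose q s := \sum_k (x s k - t k) ^+ 2.
case: (@Order.TotalTheory.arg_minP _ _ _ 1%g xpredT q isT) => s _ s_min.
exists s.
pose D (p : 'I_n * 'I_n) k : R :=
  (c p.1 (s p.2) k)%:R + (c p.2 (s p.1) k)%:R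
  - (c p.1 (s p.1) k)%:R - (c p.2 (s p.2) k)%:R.
have n_neq0 : n%:R != 0 :> R by rewrite pnatr_eq0 -lt0n.
(* For bits, [(a + b - c - d)^2 <= 2 * (a + b + c + d)], and each of the four edges has exactly one
   colour. *)
have Dnorm p : \sum_k D p k ^+ 2 <= 8.
  have -> : 8 = \sum_k 2 * ((c p.1 (s p.2) k)%:R + (c p.2 (s p.1) k)%:R
                 + (c p.1 (s p.1) k)%:R + (c p.2 (s p.2) k)%:R) :> R.
    by rewrite -mulr_sumr !big_split /= !c_sum; ring.
  apply: ler_sum => k _; rewrite /D.
  by do 4 case: (c _ _ k); rewrite /= ?mulr1n ?mulr0n; lra.
(* Equal weights suffice: the changes over all ordered pairs sum to [-2n] times the deviation. *)
apply: (cone_norm_lt R _ m D (fun k => x s k - t k) (fun _ => (2 * n%:R)^-1)) => //.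
- by move=> p k; rewrite !rpredB ?rpredD ?rpred_nat.
- by move=> p; rewrite !sumrB big_split /= !c_sum; ring.
- move=> k; rewrite -mulr_sumr -(pair_bigA _ (fun i j => D (i, j) k)) /=.
  have constE (a : R) : \sum_(j < n) a = n%:R * a.
    by rewrite sumr_const card_ord mulr_natl.
  have rowE i : \sum_j (c i (s j) k)%:R = \sum_j (c i j k)%:R :> R.
    by rewrite [RHS](reindex_perm s).
  have colE : \sum_i \sum_j (c j (s i) k)%:R = \sum_i \sum_j (c i j k)%:R :> R.
    by rewrite exchange_big; apply: eq_bigr => i _; exact: rowE.
  (* As [s] is a bijection, each of the two added edges runs once over all edges, while each removed
     edge runs [n] times over the matching. *)
  have -> : \sum_i \sum_j D (i, j) k =
      \sum_i \sum_j (c i j k)%:R + \sum_i \sum_j (c i j k)%:R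
      - n%:R * x s k - n%:R * x s k.
    under eq_bigr do rewrite /D /= !sumrB big_split /= constE rowE.
    by rewrite !sumrB big_split /= constE colE -mulr_sumr.
  by rewrite /t; field.
(* Minimality makes [2<v, D p> + |D p|^2] nonnegative, and [|D p|^2 <= 8] leaves [-4]. *)
- move=> p; have := s_min (tperm p.1 p.2 * s)%g isT.
  have -> : q (tperm p.1 p.2 * s)%g =
      q s + (2 * (\sum_k (x s k - t k) * D p k) + \sum_k D p k ^+ 2).
    rewrite mulr_sumr -!big_split /=; apply: eq_bigr => k _.
    rewrite /x (sum_tperm _ _ (fun i j => (c i j k)%:R)) -/(x s k) -/(D p k).
    by ring.
  by rewrite lerDl; have := Dnorm p; lra.
Qed.

(** * Edges and perfect matchings of the complete bipartite graph *)

Lemma card_setI_imset (I E : finType) (h : I -> E) (A : {set E}) :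
  injective h -> #|A :&: [set h i | i : I]| = (\sum_i (h i \in A))%N.
Proof.
move=> h_inj.
have -> : A :&: [set h i | i : I] = h @: [set i | h i \in A].
  apply/setP => e; rewrite inE; apply/andP/imsetP.
    by case=> eA /imsetP[i _ ei]; exists i; rewrite // inE -ei.
  by case=> i; rewrite inE => hiA ->; split; rewrite ?imset_f.
rewrite card_imset // -sum1_card big_mkcond.
by apply: eq_bigr => i _; rewrite inE; case: (_ \in _).
Qed.

Definition bip_edge (n : nat) (i j : 'I_n) : {set 'I_n + 'I_n} :=
  [set inl i; inr j].

Lemma mem_bip_edgel (n : nat) (i j a : 'I_n) : (inl a \in bip_edge n i j) = (a == i).
Proof. by rewrite !inE orbF. Qed.

Lemma mem_bip_edger (n : nat) (i j b : 'I_n) : (inr b \in bip_edge n i j) = (b == j).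
Proof. by rewrite !inE. Qed.

Lemma bip_edge_inj (n : nat) (i j a b : 'I_n) :
  bip_edge n i j = bip_edge n a b -> i = a /\ j = b.
Proof.
move=> eq_e; split; apply/eqP.
  by rewrite -(mem_bip_edgel n a b) -eq_e mem_bip_edgel.
by rewrite -(mem_bip_edger n a b) -eq_e mem_bip_edger.
Qed.

(** Every edge arises from two ordered pairs of vertices; orienting it from left to right gives an
    injective parametrization, suited to counting. *)
Lemma edges_Kbip (n : nat) :
  edges (@Kbip n) = [set bip_edge n p.1 p.2 | p : 'I_n * 'I_n].
Proof.
apply/setP => e; apply/imsetP/imsetP.
  case=> -[[i|i] [j|j]]; rewrite inE //= => _ ->.
    by exists (i, j).
  by exists (j, i); rewrite // finset.setUC.
by case=> -[i j] _ ->; exists (inl i, inr j); rewrite ?inE.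
Qed.

Lemma perm_perfect_matching (n : nat) (s : 'S_n) :
  perfect_matching (@Kbip n) [set bip_edge n i (s i) | i : 'I_n].
Proof.
split.
  apply/fintype.subsetP => e /imsetP[i _ ->]; rewrite edges_Kbip.
  by apply/imsetP; exists (i, s i).
case=> [i|j]; apply/eqP/cards1P.
  exists (bip_edge n i (s i)); apply/setP => e; rewrite !inE.
  apply/andP/eqP => [[/imsetP[a _ ->]]|->]; first by rewrite mem_bip_edgel => /eqP ->.
  by rewrite mem_bip_edgel eqxx; split=> //; apply/imsetP; exists i.
exists (bip_edge n (s^-1 j)%g j); apply/setP => e; rewrite !inE.
apply/andP/eqP => [[/imsetP[a _ ->]]|->].
  by rewrite mem_bip_edger => /eqP ->; rewrite permK.
rewrite mem_bip_edger eqxx; split=> //.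
by apply/imsetP; exists (s^-1 j)%g; rewrite ?permKV.
Qed.

Lemma edge_partition_sum1 (R : realType) (n m : nat)
    (P : 'I_m -> {set {set ('I_n + 'I_n)}}) (i j : 'I_n) :
  edge_partition (@Kbip n) P -> \sum_k (bip_edge n i j \in P k)%:R = 1 :> R.
Proof.
case=> P_cover P_disj.
have : bip_edge n i j \in edges (@Kbip n).
  by rewrite edges_Kbip; apply/imsetP; exists (i, j).
rewrite -P_cover => /bigcupP[k _ ek].
rewrite (bigD1 k) //= ek big1 ?addr0 // => l lNk.
by rewrite (disjointFl (P_disj _ _ lNk) ek).
Qed.

(** * Norm comparison, the constant, and the conclusion *)

Lemma normr_le_l2norm (R : realType) (m : nat) (v : 'rV[R]_m) : `|v| <= l2norm v.
Proof.
rewrite [`|v|]mx_normrE; apply: bigmax_le => [|[i j] _ /=]; first exact: sqrtr_ge0.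
rewrite -sqrtr_sqr ler_sqrt ?sumr_ge0 // => [|k _]; last exact: sqr_ge0.
by rewrite (ord1 i) (bigD1 j) //= lerDl sumr_ge0 // => k _; exact: sqr_ge0.
Qed.

(** With [m = d + 2] the exponent is [2 + (3/2) d], and [2^(3/2)] is the square root of 8. *)
Lemma powR2_half (R : realType) (d : nat) :
  2 `^ ((3 * d.+2%:R - 2) / 2) = 4 * Num.sqrt 8 ^+ d :> R.
Proof.
have -> : (3 * d.+2%:R - 2) / 2 = 2%:R + (3%:R * 2^-1) * d%:R :> R.
  by rewrite -addn2 natrD; field.
rewrite powRD; last by rewrite implybE pnatr_eq0 orbT.
rewrite (powRrM _ _ d%:R) (powRrM _ 3%:R) !powR_mulrn ?powR12_sqrt ?powR_ge0 //.
by congr (_ * Num.sqrt _ ^+ d); ring.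
Qed.

Theorem theorem2p1 (R : realType) (n m : nat)
    (hn : (1 <= n)%N) (hm : (2 <= m)%N)
    (P : 'I_m -> {set {set ('I_n + 'I_n)}})
    (hP : edge_partition (@Kbip n) P) :
  exists M : {set {set ('I_n + 'I_n)}},
    perfect_matching (@Kbip n) M /\
    let v : 'rV[R]_m :=
      color_vector R M P - n%:R^-1 *: color_vector R (edges (@Kbip n)) P in
    `|v| <= l2norm v < (m%:R - 1) * 2 `^ ((3 * m%:R - 2) / 2).
Proof.
case: m hm P hP => [|[|d]] // _ P hP.
have [s s_near] := perm_near_average R n d.+1 (fun i j k => bip_edge n i j \in P k)
  hn isT (fun i j => edge_partition_sum1 R n d.+2 P i j hP).
exists [set bip_edge n i (s i) | i : 'I_n]; split; first exact: perm_perfect_matching.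
move=> v; rewrite normr_le_l2norm powR2_half /=.
have -> : d.+2%:R - 1 = d.+1%:R :> R by rewrite -natr1 addrK.
(* Coordinates agree once the matching is counted along [i] and the whole edge set along pairs
   [(i, j)]. *)
congr (Num.sqrt _ < _): s_near; apply: eq_bigr => k _; congr (_ ^+ 2).
rewrite !mxE card_setI_imset; last by move=> i a /bip_edge_inj[].
rewrite edges_Kbip card_setI_imset; last by move=> [i j] [a b] /bip_edge_inj[/= -> ->].
rewrite !natr_sum; congr (_ - _ * _).
by rewrite pair_bigA.
Qed.
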